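(* Let $N=2^n$. Let $M_{\mathrm{QL}}$, $A_{\mathrm{QL}}$, $S_{\mathrm{QL}}$ be respectively the numbers of input-dependent real multiplications, of real additions and subtractions, and of multiplications by fixed scalars other than $0,\pm1$, used by the algorithm $\mathsf M_n$ (described in the context, under the counting conventions stated there) to multiply two elements of $A_n$, and let $T_{\mathrm{QL}}=M_{\mathrm{QL}}+A_{\mathrm{QL}}+S_{\mathrm{QL}}$. With complex products evaluated by the three-real-product formula given in the context and the sum of the real and imaginary parts of each input coordinate computed once per node, for every $n\ge3$, $$M_{\mathrm{QL}}=\frac{(9n-15)N}{2}+10,\qquad A_{\mathrm{QL}}=\frac{(23n-61)N}{2}+36,$$ $$S_{\mathrm{QL}}=\frac{(2n-7)N}{2}+4,\qquad T_{\mathrm{QL}}=\frac{(34n-83)N}{2}+50 .$$ For $n=1$ and $n=2$, $(M_{\mathrm{QL}},A_{\mathrm{QL}},S_{\mathrm{QL}})=(4,2,0)$ and $(16,12,0)$ respectively.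
   Context: **Cayley--Dickson tower.** $A_0:=\mathbb R$ with $\bar r=r$. Recursively $A_n:=A_{n-1}\oplus A_{n-1}$ with $$\overline{(a,b)}=(\bar a,-b),\qquad (a,b)(c,d)=\bigl(ac-\bar d\,b,\;da+b\bar c\bigr).$$ The standard (recursive, concatenated) basis identifies $A_n$ with $\mathbb R^{2^n}$ and gives its Euclidean inner product $\langle\cdot,\cdot\rangle$. Scalars are identified with multiples of the unit. Put $\operatorname{Re}(x)=\frac{x+\bar x}{2}$ (identified with its scalar coefficient), $\operatorname{Im}(x)=\frac{x-\bar x}{2}$, $V_n:=\operatorname{Im}(A_n)=\{x\in A_n:\bar x=-x\}$. **The algorithm.** Let $V_n^{\mathbb C}=V_n\otimes_{\mathbb R}\mathbb C$, $\mathbb C=\mathbb R(\iota)$, $\iota^2=-1$, with the involution extended $\mathbb C$-linearly and $\langle z,w\rangle_{\mathrm{bil}}=\sum_j z_jw_j$ (no conjugation). For $n\ge2$ every element of $V_n^{\mathbb C}$ (resp. $V_n$) is uniquely $(u,\gamma+s)$ with $u,s\in V_{n-1}^{\mathbb C}$, $\gamma\in\mathbb C$ (resp. $u,s\in V_{n-1}$, $\gamma\in\mathbb R$). $\operatorname{Re}_{\mathrm c},\operatorname{Im}_{\mathrm c}$ denote coefficientwise real and imaginary parts. - $\mathsf C_n(X,Y)$ for $n\ge 1$, $X,Y\in V_n^{\mathbb C}$: if $n=1$ return $0$. Otherwise write $X=(u,\gamma+s)$, $Y=(v,\delta+t)$; set $Z_\pm\leftarrow\mathsf C_{n-1}(u\pm\iota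 s,v\pm\iota t)$, $\lambda\leftarrow\langle s,v\rangle_{\mathrm{bil}}-\langle t,u\rangle_{\mathrm{bil}}$, $F\leftarrow (Z_++Z_-)/2+\gamma t-\delta s$, $G\leftarrow\lambda+\delta u-\gamma v+\iota(Z_+-Z_-)/2$; return $(F,G)$. - $\mathsf R_n(X,Y)$ for $n\ge 1$, $X,Y\in V_n$: if $n=1$ return $0$. Otherwise write $X=(u,\gamma+s)$, $Y=(v,\delta+t)$; set $Z\leftarrow\mathsf C_{n-1}(u+\iota s,v+\iota t)$, $\lambda\leftarrow\langle s,v\rangle-\langle t,u\rangle$, $F\leftarrow\operatorname{Re}_{\mathrm c}Z+\gamma t-\delta s$, $G\leftarrow\lambda+\delta u-\gamma v-\operatorname{Im}_{\mathrm c}Z$; return $(F,G)$. - $\mathsf M_n(x,y)$ for $n\ge 0$, $x,y\in A_n$: if $n=0$ return the real product $xy$. Otherwise set $\alpha=\operatorname{Re}(x)$, $X=\operatorname{Im}(x)$, $\beta=\operatorname{Re}(y)$, $Y=\operatorname{Im}(y)$, $Z\leftarrow\mathsf R_n(X,Y)$; return $(\alpha\beta-\langle X,Y\rangle)+\alpha Y+\beta X+Z$. **Counting conventions.** Every counted operation costs one. Known-zero terms are omitted (in particular, operations involving quantities known to vanish, such as values of $\mathsf C_1$ or $\mathsf R_1$ and the inputs formed only for them, and addition of $\lambda$ in a coordinate where all other terms are zero) and sums are initialized from their first term. Preprocessing of both variable operands is included in the total cost. Coordinate extraction, copying, permutations, and sign changes are not charged (so multiplication by $\iota$, a coordinate exchange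 and sign change, is free, and so is assembling a complex vector from two real vectors), and scalar and imaginary parts are obtained directly from the standard-basis coordinates. Complex products are evaluated by $(a+\iota b)(c+\iota d)=(p-q)+\iota(r-p-q)$ with $p=ac$, $q=bd$, $r=(a+b)(c+d)$. At each complex node (evaluation of $\mathsf C_k$) the sum of the real and imaginary parts of each input coordinate ($\gamma$, $\delta$, and each coordinate of $u,v,s,t$) is computed only once and reused in all products at that node. *)

(* Defs.v *)
From HB Require Import structures.
From mathcomp Require Import all_boot all_order all_algebra.
From mathcomp Require Import reals.
From mathcomp Require Export complex.
From mathcomp Require Import ring.
Set Implicit Arguments.
Unset Strict Implicit.
Unset Printing Implicit Defensive.
Import Order.TTheory GRing.Theory Num.Theory.
Local Open Scope ring_scope.
Local Open Scope complex_scope.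

(* [CD R n] is A_n; [CD R[i] n] is its complexification.  The coordinate type
   is arbitrary because the cost model below uses annotated coordinates. *)
Fixpoint CD (K : Type) (n : nat) : Type :=
  if n is m.+1 then (CD K m * CD K m)%type else K.

Fixpoint cdmap (K L : Type) (f : K -> L) n : CD K n -> CD L n :=
  match n with
  | 0 => f
  | m.+1 => fun x => (cdmap f x.1, cdmap f x.2)
  end.

Fixpoint cdmap2 (K L P : Type) (f : K -> L -> P) n :
    CD K n -> CD L n -> CD P n :=
  match n with
  | 0 => f
  | m.+1 => fun x y => (cdmap2 f x.1 y.1, cdmap2 f x.2 y.2)
  end.

Fixpoint cdconst (K : Type) (a : K) n : CD K n :=
  match n with
  | 0 => a
  | m.+1 => (cdconst a m, cdconst a m)
  end.

Fixpoint cdRe (K : Type) n : CD K n -> K :=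
  match n with
  | 0 => id
  | m.+1 => fun x => cdRe x.1
  end.

Fixpoint cdsetRe (K : Type) (a : K) n : CD K n -> CD K n :=
  match n with
  | 0 => fun _ => a
  | m.+1 => fun x => (cdsetRe a x.1, x.2)
  end.

Section Ring.
Variable K : pzRingType.

Definition cdzero n : CD K n := cdconst 0 n.
Definition cdscalar (a : K) n : CD K n := cdsetRe a (cdzero n).
Definition cdIm n (x : CD K n) : CD K n := cdsetRe 0 x.
Definition cdadd n (x y : CD K n) : CD K n := cdmap2 +%R x y.
Definition cdopp n (x : CD K n) : CD K n := cdmap -%R x.
Definition cdsub n (x y : CD K n) : CD K n := cdadd x (cdopp y).
Definition cdscale (a : K) n (x : CD K n) : CD K n := cdmap ( *%R a) x.

Fixpoint cdconj n : CD K n -> CD K n :=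
  match n with
  | 0 => id
  | m.+1 => fun x => (cdconj x.1, cdopp x.2)
  end.

Fixpoint cddot n : CD K n -> CD K n -> K :=
  match n with
  | 0 => *%R
  | m.+1 => fun x y => cddot x.1 y.1 + cddot x.2 y.2
  end.

End Ring.

Arguments cdzero {K} n.
Arguments cdscalar {K} a n.

Section ReIm.
Variable R : realFieldType.

Let half2 (a : R) : 2^-1 * (a + a) = a.
Proof. by rewrite -mulr2n -(mulr_natl a) mulKf // pnatr_eq0. Qed.

Lemma cdReP n (x : CD R n) :
  cdscalar (cdRe x) n = cdscale 2^-1 (cdadd x (cdconj x)).
Proof.
elim: n x => [|n IHn] x /=; first by rewrite /cdscalar /cdscale /cdadd /= half2.
have yP (y : CD R n) : cdscale 2^-1 (cdadd y (cdopp y)) = cdzero n.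
  elim: n y {x IHn} => [|n IHn] y.
    by rewrite /cdscale /cdadd /cdopp /cdzero /= subrr mulr0.
  by congr (_, _); apply: IHn.
by congr (_, _); [apply: IHn | exact: (esym (yP x.2))].
Qed.

Lemma cdImP n (x : CD R n) : cdIm x = cdscale 2^-1 (cdsub x (cdconj x)).
Proof.
elim: n x => [|n IHn] x /=.
  by rewrite /cdIm /cdscale /cdsub /cdadd /cdopp /= subrr mulr0.
have yP (y : CD R n) : cdscale 2^-1 (cdadd y (cdopp (cdopp y))) = y.
  elim: n y {x IHn} => [|n IHn] y.
    by rewrite /cdscale /cdadd /cdopp /= opprK half2.
  by rewrite [RHS]surjective_pairing; congr (_, _); apply: IHn.
by congr (_, _); [apply: IHn | exact: (esym (yP x.2))].
Qed.

End ReIm.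

(* An element (u, gamma + s) of V_n is an element x of A_n with zero scalar
   coordinate: u = x.1, gamma = cdRe x.2, s = cdIm x.2.
   C_n and R_n are only meant for n >= 1; the value at index 0 is a dummy. *)
Section Algorithm.
Variable R : realFieldType.
Let iota : R[i] := 0 +i* 1.

Fixpoint qlC n : CD R[i] n -> CD R[i] n -> CD R[i] n :=
  match n with
  | 0 => fun _ _ => cdzero 0
  | m.+1 => fun X Y =>
    if m == 0%N then cdzero m.+1 else
    let u : CD R[i] m := X.1 in
    let gamma := cdRe X.2 in let s := cdIm X.2 in
    let v : CD R[i] m := Y.1 in
    let delta := cdRe Y.2 in let t := cdIm Y.2 in
    let Zp := qlC (cdadd u (cdscale iota s)) (cdadd v (cdscale iota t)) in
    let Zm := qlC (cdsub u (cdscale iota s)) (cdsub v (cdscale iota t)) in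
    let lambda := cddot s v - cddot t u in
    let F := cdsub (cdadd (cdscale 2^-1 (cdadd Zp Zm)) (cdscale gamma t))
                   (cdscale delta s) in
    let G := cdadd (cdsub (cdadd (cdscalar lambda m) (cdscale delta u))
                          (cdscale gamma v))
                   (cdscale iota (cdscale 2^-1 (cdsub Zp Zm))) in
    (F, G)
  end.

Definition qlR n : CD R n -> CD R n -> CD R n :=
  match n return CD R n -> CD R n -> CD R n with
  | 0 => fun _ _ => cdzero 0
  | m.+1 => fun X Y =>
    if m == 0%N then cdzero m.+1 else
    let u : CD R m := X.1 in
    let gamma := cdRe X.2 in let s := cdIm X.2 in
    let v : CD R m := Y.1 in
    let delta := cdRe Y.2 in let t := cdIm Y.2 in
    let Z := qlC (cdmap2 (@Complex R) u s) (cdmap2 (@Complex R) v t) in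
    let lambda := cddot s v - cddot t u in
    let F := cdsub (cdadd (cdmap (@complex.Re R) Z) (cdscale gamma t))
                   (cdscale delta s) in
    let G := cdsub (cdsub (cdadd (cdscalar lambda m) (cdscale delta u))
                          (cdscale gamma v))
                   (cdmap (@complex.Im R) Z) in
    (F, G)
  end.

Definition qlM n : CD R n -> CD R n -> CD R n :=
  match n return CD R n -> CD R n -> CD R n with
  | 0 => *%R
  | m.+1 => fun x y =>
    let alpha := cdRe x in let X := cdIm x in
    let beta := cdRe y in let Y := cdIm y in
    let Z := qlR X Y in
    cdadd (cdadd (cdadd (cdscalar (alpha * beta - cddot X Y) m.+1)
                        (cdscale alpha Y))
                 (cdscale beta X))
          Z
  end.

End Algorithm.

Record counts := Counts {
  nmul : nat;    (* real multiplications of two input-dependent quantities *)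
  nadd : nat;    (* real additions and subtractions *)
  nscale : nat   (* real multiplications by a fixed scalar other than 0, +-1 *)
}.

Definition addc (c d : counts) : counts :=
  Counts (nmul c + nmul d) (nadd c + nadd d) (nscale c + nscale d).

Definition cost (T : Type) : Type := (T * counts)%type.
Definition ret (T : Type) (x : T) : cost T := (x, Counts 0 0 0).
Definition bind (T U : Type) (m : cost T) (f : T -> cost U) : cost U :=
  ((f m.1).1, addc m.2 (f m.1).2).

Notation "'let*' x ':=' m 'in' k" := (bind m (fun x => k))
  (at level 200, x name, m at level 200, k at level 200,
   format "'[v' 'let*'  x  ':='  m  'in' '/' k ']'").

Fixpoint cdmapM (K L : Type) (f : K -> cost L) n : CD K n -> cost (CD L n) :=
  match n with
  | 0 => f
  | m.+1 => fun x =>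
    let* a := cdmapM f x.1 in
    let* b := cdmapM f x.2 in
    ret (a, b)
  end.

Fixpoint cdmap2M (K L P : Type) (f : K -> L -> cost P) n :
    CD K n -> CD L n -> cost (CD P n) :=
  match n with
  | 0 => f
  | m.+1 => fun x y =>
    let* a := cdmap2M f x.1 y.1 in
    let* b := cdmap2M f x.2 y.2 in
    ret (a, b)
  end.

Fixpoint cddotM (K L P : Type) (mul : K -> L -> cost P)
    (add : P -> P -> cost P) n : CD K n -> CD L n -> cost P :=
  match n with
  | 0 => mul
  | m.+1 => fun x y =>
    let* a := cddotM mul add x.1 y.1 in
    let* b := cddotM mul add x.2 y.2 in
    add a b
  end.

Section Instrumented.
Variable R : realFieldType.

(* [None] is a quantity known to vanish; operations involving it are free. *)
Definition tracked := option R.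

Definition tmul (a b : tracked) : cost tracked :=
  match a, b with
  | Some a, Some b => (Some (a * b), Counts 1 0 0)
  | _, _ => ret None
  end.

Definition tadd (a b : tracked) : cost tracked :=
  match a, b with
  | Some a, Some b => (Some (a + b), Counts 0 1 0)
  | Some a, None => ret (Some a)
  | None, b => ret b
  end.

Definition topp (a : tracked) : tracked := omap -%R a.
Definition tsub (a b : tracked) : cost tracked := tadd a (topp b).

Definition thalf (a : tracked) : cost tracked :=
  if a is Some a then (Some (2^-1 * a), Counts 0 0 1) else ret None.

(* Complex coordinates, as pairs (real part, imaginary part). *)
Definition ctracked : Type := (tracked * tracked)%type.

Definition ctzero : ctracked := (None, None).

Definition ctadd (z w : ctracked) : cost ctracked :=
  let* a := tadd z.1 w.1 in
  let* b := tadd z.2 w.2 in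
  ret (a, b).

Definition ctsub (z w : ctracked) : cost ctracked :=
  let* a := tsub z.1 w.1 in
  let* b := tsub z.2 w.2 in
  ret (a, b).

Definition cthalf (z : ctracked) : cost ctracked :=
  let* a := thalf z.1 in
  let* b := thalf z.2 in
  ret (a, b).

Definition ctiota (z : ctracked) : ctracked := (topp z.2, z.1).

(* A complex number together with the sum of its real and imaginary parts,
   computed by [ctprep] and then shared by all products using that number. *)
Definition prepared : Type := (ctracked * tracked)%type.

Definition ctprep (z : ctracked) : cost prepared :=
  let* s := tadd z.1 z.2 in
  ret (z, s).

Definition ctmul (z w : prepared) : cost ctracked :=
  let* p := tmul z.1.1 w.1.1 in
  let* q := tmul z.1.2 w.1.2 in
  let* r := tmul z.2 w.2 in
  let* re := tsub p q in
  let* rp := tsub r p in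
  let* im := tsub rp q in
  ret (re, im).

(* The two arguments are passed unevaluated: [qlCM] of index 1 does not run
   the computations forming its inputs, so these are not charged. *)
Fixpoint qlCM n : cost (CD ctracked n) -> cost (CD ctracked n) ->
    cost (CD ctracked n) :=
  match n with
  | 0 => fun _ _ => ret (cdconst ctzero 0)
  | m.+1 => fun mX mY =>
    if m == 0%N then ret (cdconst ctzero m.+1) else
    let* X := mX in
    let* Y := mY in
    let u : CD ctracked m := X.1 in
    let gamma := cdRe X.2 in let s := cdsetRe ctzero X.2 in
    let v : CD ctracked m := Y.1 in
    let delta := cdRe Y.2 in let t := cdsetRe ctzero Y.2 in
    let js := cdmap ctiota s in
    let jt := cdmap ctiota t in
    let* Zp := qlCM (cdmap2M ctadd u js) (cdmap2M ctadd v jt) in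
    let* Zm := qlCM (cdmap2M ctsub u js) (cdmap2M ctsub v jt) in
    let* gamma' := ctprep gamma in
    let* delta' := ctprep delta in
    let* u' := cdmapM ctprep u in
    let* v' := cdmapM ctprep v in
    let* s' := cdmapM ctprep s in
    let* t' := cdmapM ctprep t in
    let* sv := cddotM ctmul ctadd s' v' in
    let* tu := cddotM ctmul ctadd t' u' in
    let* lambda := ctsub sv tu in
    let* ZS := cdmap2M ctadd Zp Zm in
    let* ZS2 := cdmapM cthalf ZS in
    let* gt := cdmapM (ctmul gamma') t' in
    let* ds := cdmapM (ctmul delta') s' in
    let* F1 := cdmap2M ctadd ZS2 gt in
    let* F := cdmap2M ctsub F1 ds in
    let* du := cdmapM (ctmul delta') u' in
    let* gv := cdmapM (ctmul gamma') v' in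
    let* ZD := cdmap2M ctsub Zp Zm in
    let* ZD2 := cdmapM cthalf ZD in
    let* G1 := cdmap2M ctadd (cdsetRe lambda (cdconst ctzero m)) du in
    let* G2 := cdmap2M ctsub G1 gv in
    let* G := cdmap2M ctadd G2 (cdmap ctiota ZD2) in
    ret (F, G)
  end.

Definition qlRM n : CD tracked n -> CD tracked n -> cost (CD tracked n) :=
  match n return CD tracked n -> CD tracked n -> cost (CD tracked n) with
  | 0 => fun _ _ => ret (cdconst None 0)
  | m.+1 => fun X Y =>
    if m == 0%N then ret (cdconst None m.+1) else
    let u : CD tracked m := X.1 in
    let gamma := cdRe X.2 in let s := cdsetRe None X.2 in
    let v : CD tracked m := Y.1 in
    let delta := cdRe Y.2 in let t := cdsetRe None Y.2 in
    let* Z := qlCM (ret (cdmap2 pair u s)) (ret (cdmap2 pair v t)) in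
    let* sv := cddotM tmul tadd s v in
    let* tu := cddotM tmul tadd t u in
    let* lambda := tsub sv tu in
    let* gt := cdmapM (tmul gamma) t in
    let* ds := cdmapM (tmul delta) s in
    let* F1 := cdmap2M tadd (cdmap fst Z) gt in
    let* F := cdmap2M tsub F1 ds in
    let* du := cdmapM (tmul delta) u in
    let* gv := cdmapM (tmul gamma) v in
    let* G1 := cdmap2M tadd (cdsetRe lambda (cdconst None m)) du in
    let* G2 := cdmap2M tsub G1 gv in
    let* G := cdmap2M tsub G2 (cdmap snd Z) in
    ret (F, G)
  end.

Definition qlMM n : CD tracked n -> CD tracked n -> cost (CD tracked n) :=
  match n return CD tracked n -> CD tracked n -> cost (CD tracked n) with
  | 0 => tmul
  | m.+1 => fun x y =>
    let alpha := cdRe x in let X := cdsetRe None x in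
    let beta := cdRe y in let Y := cdsetRe None y in
    let* Z := qlRM X Y in
    let* ab := tmul alpha beta in
    let* XY := cddotM tmul tadd X Y in
    let* sc := tsub ab XY in
    let* aY := cdmapM (tmul alpha) Y in
    let* bX := cdmapM (tmul beta) X in
    let* W1 := cdmap2M tadd (cdsetRe sc (cdconst None m.+1)) aY in
    let* W2 := cdmap2M tadd W1 bX in
    cdmap2M tadd W2 Z
  end.

Definition ql_run n (x y : CD R n) : cost (CD tracked n) :=
  qlMM (cdmap Some x) (cdmap Some y).

Definition M_QL n (x y : CD R n) : nat := nmul (ql_run x y).2.
Definition A_QL n (x y : CD R n) : nat := nadd (ql_run x y).2.
Definition S_QL n (x y : CD R n) : nat := nscale (ql_run x y).2.
Definition T_QL n (x y : CD R n) : nat := (M_QL x y + A_QL x y + S_QL x y)%N.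

End Instrumented.

Section Erasure.
Variable R : realFieldType.

Definition tval (a : tracked R) : R := odflt 0 a.
Definition ctval (z : ctracked R) : R[i] := tval z.1 +i* tval z.2.

Lemma tmul_val a b : tval (tmul a b).1 = tval a * tval b.
Proof. by case: a b => [a|] [b|]; rewrite /= ?mul0r ?mulr0. Qed.

Lemma tadd_val a b : tval (tadd a b).1 = tval a + tval b.
Proof. by case: a b => [a|] [b|]; rewrite /= ?add0r ?addr0. Qed.

Lemma topp_val a : tval (topp a) = - tval a.
Proof. by case: a => [a|] //=; rewrite oppr0. Qed.

Lemma tsub_val a b : tval (tsub a b).1 = tval a - tval b.
Proof. by rewrite /tsub tadd_val topp_val. Qed.

Lemma thalf_val a : tval (thalf a).1 = 2^-1 * tval a.
Proof. by case: a => [a|] //=; rewrite mulr0. Qed.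

Lemma ctadd_val z w : ctval (ctadd z w).1 = ctval z + ctval w.
Proof. by rewrite /ctval /= !tadd_val. Qed.

Lemma ctsub_val z w : ctval (ctsub z w).1 = ctval z - ctval w.
Proof. by rewrite /ctval /= !tsub_val. Qed.

Lemma cthalf_val z : ctval (cthalf z).1 = 2^-1 * ctval z.
Proof.
have -> : 2^-1 = (2^-1)%:C :> R[i] by rewrite fmorphV rmorphD rmorph1.
rewrite /ctval /= !thalf_val.
by apply/eqP; rewrite eq_complex /= !mul0r subr0 addr0 !eqxx.
Qed.

Lemma ctiota_val z : ctval (ctiota z) = (0 +i* 1) * ctval z.
Proof.
rewrite /ctval /= topp_val.
by apply/eqP; rewrite eq_complex /= !mul0r !mul1r sub0r add0r !eqxx.
Qed.

Lemma ctmul_val z w :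
  ctval (ctmul (ctprep z).1 (ctprep w).1).1 = ctval z * ctval w.
Proof.
rewrite /ctval /= !tsub_val !tmul_val !tadd_val.
apply/eqP; rewrite eq_complex /= eqxx /=; apply/eqP; ring.
Qed.

Lemma cdmapM1 (K L : Type) (f : K -> cost L) n (x : CD K n) :
  (cdmapM f x).1 = cdmap (fun a => (f a).1) x.
Proof. by elim: n x => //= n IHn x; rewrite !IHn. Qed.

Lemma cdmap2M1 (K L P : Type) (f : K -> L -> cost P) n
    (x : CD K n) (y : CD L n) :
  (cdmap2M f x y).1 = cdmap2 (fun a b => (f a b).1) x y.
Proof. by elim: n x y => //= n IHn x y; rewrite !IHn. Qed.

Lemma cdmap_comp (K L P Q : Type) (g : L -> P) (f : K -> L) (h : Q -> P)
    (e : K -> Q) n (x : CD K n) :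
  (forall a, g (f a) = h (e a)) -> cdmap g (cdmap f x) = cdmap h (cdmap e x).
Proof. by move=> E; elim: n x => [|n IHn] x /=; rewrite ?E ?IHn. Qed.

Lemma cdmap_map2 (K L P K' L' P' : Type) (g : P -> P') (f : K -> L -> P)
    (h : K' -> L' -> P') (e1 : K -> K') (e2 : L -> L') n
    (x : CD K n) (y : CD L n) :
  (forall a b, g (f a b) = h (e1 a) (e2 b)) ->
  cdmap g (cdmap2 f x y) = cdmap2 h (cdmap e1 x) (cdmap e2 y).
Proof. by move=> E; elim: n x y => [|n IHn] x y /=; rewrite ?E ?IHn. Qed.

Lemma cdmap_setRe (K L : Type) (g : K -> L) a n (x : CD K n) :
  cdmap g (cdsetRe a x) = cdsetRe (g a) (cdmap g x).
Proof. by elim: n x => //= n IHn x; rewrite IHn. Qed.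

Lemma cdmap_const (K L : Type) (g : K -> L) a n :
  cdmap g (cdconst a n) = cdconst (g a) n.
Proof. by elim: n => //= n ->. Qed.

Lemma cdRe_map (K L : Type) (g : K -> L) n (x : CD K n) :
  cdRe (cdmap g x) = g (cdRe x).
Proof. by elim: n x => //=. Qed.

Lemma cddotM_val (K K' L : Type) (S : pzRingType) (g : L -> S) (e : K -> S)
    (p : K -> K') (mul : K' -> K' -> cost L) (add : L -> L -> cost L) :
  (forall a b, g (mul (p a) (p b)).1 = e a * e b) ->
  (forall a b, g (add a b).1 = g a + g b) ->
  forall n (x y : CD K n),
  g (cddotM mul add (cdmap p x) (cdmap p y)).1 = cddot (cdmap e x) (cdmap e y).
Proof. by move=> Em Ea; elim=> //= n IHn x y; rewrite Ea !IHn. Qed.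

Lemma cdmapM_ctadd n (x y : CD (ctracked R) n) :
  cdmap ctval (cdmap2M (@ctadd R) x y).1
    = cdadd (cdmap ctval x) (cdmap ctval y).
Proof. by rewrite cdmap2M1; apply: cdmap_map2 => a b; apply: ctadd_val. Qed.

Lemma cdmapM_ctsub n (x y : CD (ctracked R) n) :
  cdmap ctval (cdmap2M (@ctsub R) x y).1
    = cdsub (cdmap ctval x) (cdmap ctval y).
Proof.
rewrite cdmap2M1 /cdsub /cdadd; elim: n x y => [|n IHn] x y /=.
  exact: ctsub_val.
by congr (_, _); apply: IHn.
Qed.

Lemma cdmapM_cthalf n (x : CD (ctracked R) n) :
  cdmap ctval (cdmapM (@cthalf R) x).1 = cdscale 2^-1 (cdmap ctval x).
Proof. by rewrite cdmapM1; apply: cdmap_comp => a; apply: cthalf_val. Qed.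

Lemma cdmap_ctiota n (x : CD (ctracked R) n) :
  cdmap ctval (cdmap (@ctiota R) x) = cdscale (0 +i* 1) (cdmap ctval x).
Proof. by apply: cdmap_comp => a; apply: ctiota_val. Qed.

Lemma cdmapM_ctmul a n (x : CD (ctracked R) n) :
  cdmap ctval (cdmapM (ctmul (ctprep a).1) (cdmapM (@ctprep R) x).1).1
    = cdscale (ctval a) (cdmap ctval x).
Proof.
rewrite !cdmapM1; elim: n x => [|n IHn] x; first by apply: ctmul_val.
by congr (_, _); apply: IHn.
Qed.

Lemma cddotM_ct n (x y : CD (ctracked R) n) :
  ctval (cddotM (@ctmul R) (@ctadd R)
           (cdmapM (@ctprep R) x).1 (cdmapM (@ctprep R) y).1).1
    = cddot (cdmap ctval x) (cdmap ctval y).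
Proof.
rewrite !cdmapM1; apply: (cddotM_val (S := R[i])) => a b.
  exact: ctmul_val.
exact: ctadd_val.
Qed.

Lemma cdmapM_tadd n (x y : CD (tracked R) n) :
  cdmap tval (cdmap2M (@tadd R) x y).1 = cdadd (cdmap tval x) (cdmap tval y).
Proof. by rewrite cdmap2M1; apply: cdmap_map2 => a b; apply: tadd_val. Qed.

Lemma cdmapM_tsub n (x y : CD (tracked R) n) :
  cdmap tval (cdmap2M (@tsub R) x y).1 = cdsub (cdmap tval x) (cdmap tval y).
Proof.
rewrite cdmap2M1 /cdsub /cdadd; elim: n x y => [|n IHn] x y /=.
  exact: tsub_val.
by congr (_, _); apply: IHn.
Qed.

Lemma cdmapM_tmul a n (x : CD (tracked R) n) :
  cdmap tval (cdmapM (tmul a) x).1 = cdscale (tval a) (cdmap tval x).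
Proof. by rewrite cdmapM1; apply: cdmap_comp => b; apply: tmul_val. Qed.

Lemma cddotM_t n (x y : CD (tracked R) n) :
  tval (cddotM (@tmul R) (@tadd R) x y).1
    = cddot (cdmap tval x) (cdmap tval y).
Proof.
elim: n x y => [|n IHn] x y; first exact: tmul_val.
by rewrite /= tadd_val !IHn.
Qed.

Definition ctE := (cdmapM_ctadd, cdmapM_ctsub, cdmapM_cthalf, cdmap_ctiota,
  cdmapM_ctmul, cddotM_ct, ctsub_val, cdRe_map).
Definition tE := (cdmapM_tadd, cdmapM_tsub, cdmapM_tmul, cddotM_t,
  tsub_val, tmul_val, cdmap_setRe, cdmap_const, cdRe_map).

Lemma qlCM_val n (mX mY : cost (CD (ctracked R) n)) :
  cdmap ctval (qlCM mX mY).1 = qlC (cdmap ctval mX.1) (cdmap ctval mY.1).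
Proof.
elim: n mX mY => [|m IHm] mX mY; first by [].
cbn [qlCM qlC]; case: ifP => [_|_]; first by cbn [ret fst]; rewrite cdmap_const.
cbn [bind ret fst snd cdmap].
by rewrite !ctE !IHm !ctE !cdmap_setRe cdmap_const !ctE !cdmap_setRe.
Qed.

Lemma qlRM_val n (X Y : CD (tracked R) n) :
  cdmap tval (qlRM X Y).1 = qlR (cdmap tval X) (cdmap tval Y).
Proof.
case: n X Y => [|m] X Y; first by [].
cbn [qlRM qlR]; case: ifP => [_|_]; first by cbn [ret fst]; rewrite cdmap_const.
cbn [bind ret fst snd cdmap].
have pairE (u s : CD (tracked R) m) : cdmap ctval (cdmap2 pair u s)
    = cdmap2 (@Complex R) (cdmap tval u) (cdmap tval s).
  exact: cdmap_map2.
have fstE (Z : CD (ctracked R) m) :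
    cdmap tval (cdmap fst Z) = cdmap (@complex.Re R) (cdmap ctval Z).
  exact: cdmap_comp.
have sndE (Z : CD (ctracked R) m) :
    cdmap tval (cdmap snd Z) = cdmap (@complex.Im R) (cdmap ctval Z).
  exact: cdmap_comp.
by rewrite !tE fstE sndE !qlCM_val; cbn [ret fst]; rewrite !pairE !tE.
Qed.

Lemma ql_run_val n (x y : CD R n) : cdmap tval (ql_run x y).1 = qlM x y.
Proof.
have SomeK m (z : CD R m) : cdmap tval (cdmap Some z) = z.
  by elim: m z => [|m IHm] //= z; rewrite !IHm -surjective_pairing.
case: n x y => [|m] x y; first by [].
rewrite /ql_run; move: (SomeK m.+1 x) (SomeK m.+1 y).
move: (cdmap Some x) (cdmap Some y) => X Y <- <-.
rewrite /qlMM /qlM; cbn [bind ret fst snd].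
by rewrite !tE qlRM_val !tE.
Qed.

End Erasure.

(* Main.v *)
Require Import Defs.
From mathcomp Require Import all_boot all_order all_algebra.
From mathcomp Require Import reals.
From mathcomp Require Import lra zify.
Import GRing.Theory.
Set Implicit Arguments.
Unset Strict Implicit.
Unset Printing Implicit Defensive.
Local Open Scope ring_scope.

(** The cost of a run depends only on which coordinates are known to vanish,
    and along the algorithm this information is always of one simple form: the
    real coordinate has one status and all the other coordinates share
    another one.  Such a pattern is recorded by two booleans ([shape]), and
    [run m P c] says that the computation [m] returns a value satisfying [P] at
    cost exactly [c]; [run_bind] composes such facts along a program.

    Each elementary operation acts on statuses as a boolean operation: a sum is
    live when one of its terms is, a product when both of its factors are,
    and either operation is charged when both operands are live.  Coordinatewise
    maps and dot products then cost a fixed amount per live coordinate.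

    With H = 2^m, a node of index m+1 receives purely imaginary inputs and its
    products (two dot products and four scalings of vectors) each run over H - 1
    live coordinates, whence 6 * 3 * (H - 1) real multiplications.  The other
    counts are proportional to H - 1 too ([node_cost]); the only distinction is
    whether the recursive values are live, which fails exactly when m <= 1.
    Then forming the recursive inputs, halving, and adding the recursive values
    are all free.  So the cost of index m+1 is a node cost plus twice the cost
    of index m, and solving this recurrence ([call_cost_closed]) produces the
    terms n 2^n.  The real levels R_n and M_n make a single complex call, at
    index n - 1, and add only multiples of 2^n and constants to its cost. *)

Local Open Scope nat_scope.

(** * Exact costs of programs *)

Definition mulc (k : nat) (c : counts) : counts :=
  Counts (k * nmul c) (k * nadd c) (k * nscale c).

Lemma counts_eq (c d : counts) :
  nmul c = nmul d -> nadd c = nadd d -> nscale c = nscale d -> c = d.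
Proof. by case: c d => [? ? ?] [? ? ?] /= -> -> ->. Qed.

Definition run (T : Type) (m : cost T) (P : T -> Prop) (c : counts) : Prop :=
  P m.1 /\ m.2 = c.

Lemma run_bind (T U : Type) (m : cost T) (f : T -> cost U) P c Q d :
  run m P c -> (forall x, P x -> run (f x) Q d) ->
  run (bind m f) Q (addc c d).
Proof. by move=> [Pm <-] /(_ _ Pm) [Qf <-]. Qed.

Lemma run_ret (T : Type) (x : T) (P : T -> Prop) :
  P x -> run (ret x) P (Counts 0 0 0).
Proof. by []. Qed.

Lemma run_eq (T : Type) (m : cost T) P c d : run m P c -> c = d -> run m P d.
Proof. by move=> ? <-. Qed.

(** * Patterns of live coordinates *)

Section Shape.
Variables (K : Type) (L : bool -> K -> Prop).

(** [L b a] says that the coordinate [a] has status [b]; the real coordinate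
    has status [b0].  The second half of a vector contains no real coordinate
    and has the pattern [(b, b)], so both parameters must be free. *)
Fixpoint shape (b0 b : bool) n : CD K n -> Prop :=
  match n with
  | 0 => L b0
  | m.+1 => fun x => shape b0 b x.1 /\ shape b b x.2
  end.

Lemma shape_Re b0 b n (x : CD K n) : shape b0 b x -> L b0 (cdRe x).
Proof. by elim: n x => //= n IHn x [/IHn]. Qed.

Lemma shape_setRe b0 b b1 a n (x : CD K n) :
  L b1 a -> shape b0 b x -> shape b1 b (cdsetRe a x).
Proof. by move=> La; elim: n x => //= n IHn x [/IHn]. Qed.

Lemma shape_const b a n : L b a -> shape b b (cdconst a n).
Proof. by move=> La; elim: n => //= n. Qed.

Lemma shape_eq a0 a b0 b n (x : CD K n) :
  shape a0 a x -> a0 = b0 -> a = b -> shape b0 b x.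
Proof. by move=> Lx <- <-. Qed.

End Shape.

Arguments shape {K} L b0 b {n}.

Lemma shape_map (K K' : Type) (L : bool -> K -> Prop) (L' : bool -> K' -> Prop)
    (g : K -> K') :
  (forall b x, L b x -> L' b (g x)) ->
  forall b0 b n (x : CD K n), shape L b0 b x -> shape L' b0 b (cdmap g x).
Proof.
move=> Lg b0 b n; elim: n b0 => [|n IHn] b0 x /=; first exact: Lg.
by move=> [/IHn ? /IHn ?].
Qed.

Lemma shape_map2 (K K' : Type) (L : bool -> K -> Prop) (L' : bool -> K' -> Prop)
    (g : K -> K -> K') :
  (forall b x y, L b x -> L b y -> L' b (g x y)) ->
  forall b0 b n (x y : CD K n),
  shape L b0 b x -> shape L b0 b y -> shape L' b0 b (cdmap2 g x y).
Proof.
move=> Lg b0 b n; elim: n b0 => [|n IHn] b0 x y /=; first exact: Lg.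
by move=> [x1 x2] [y1 y2]; split; apply: IHn.
Qed.

Definition nlive n (b0 b : bool) : nat := b0 + (2 ^ n - 1) * b.

Lemma nliveS n b0 b : nlive n.+1 b0 b = nlive n b0 b + nlive n b b.
Proof.
rewrite /nlive expnS; have := expn_gt0 2 n; move: (2 ^ n) => H.
by case: b0 b => [] [] /=; lia.
Qed.

Lemma run_cdmapM (K K' : Type) (L : bool -> K -> Prop) (L' : bool -> K' -> Prop)
    (f : K -> cost K') c :
  (forall b x, L b x -> run (f x) (L' b) (mulc b c)) ->
  forall b0 b n (x : CD K n), shape L b0 b x ->
  run (cdmapM f x) (shape L' b0 b) (mulc (nlive n b0 b) c).
Proof.
move=> Lf b0 b n; elim: n b0 => [|n IHn] b0 x /=.
  by move=> /Lf; rewrite /nlive /= addn0.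
move=> [/IHn x1 /IHn x2]; apply: run_eq.
  apply: (run_bind x1) => y1 S1.
  apply: (run_bind x2) => y2 S2.
  exact: (@run_ret _ (y1, y2) (shape L' b0 b (n := n.+1))).
by rewrite nliveS; apply: counts_eq => /=; rewrite addn0 mulnDl.
Qed.

Lemma run_cdmap2M (K1 K2 K' : Type) (L1 : bool -> K1 -> Prop)
    (L2 : bool -> K2 -> Prop) (L' : bool -> K' -> Prop)
    (f : K1 -> K2 -> cost K') c :
  (forall a b x y, L1 a x -> L2 b y ->
     run (f x y) (L' (a || b)) (mulc (a && b) c)) ->
  forall a0 a b0 b n (x : CD K1 n) (y : CD K2 n),
  shape L1 a0 a x -> shape L2 b0 b y ->
  run (cdmap2M f x y) (shape L' (a0 || b0) (a || b))
    (mulc (nlive n (a0 && b0) (a && b)) c).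
Proof.
move=> Lf a0 a b0 b n; elim: n a0 b0 => [|n IHn] a0 b0 x y /=.
  by move=> Lx Ly; have := Lf _ _ _ _ Lx Ly; rewrite /nlive /= addn0.
move=> [x1 x2] [y1 y2]; apply: run_eq.
  apply: (run_bind (IHn _ _ _ _ x1 y1)) => z1 S1.
  apply: (run_bind (IHn _ _ _ _ x2 y2)) => z2 S2.
  exact: (@run_ret _ (z1, z2) (shape L' (a0 || b0) (a || b) (n := n.+1))).
by rewrite nliveS; apply: counts_eq => /=; rewrite addn0 mulnDl.
Qed.

Section Dot.
Variables (K K' : Type) (L : bool -> K -> Prop) (L' : bool -> K' -> Prop).
Variables (mul : K -> K -> cost K') (add : K' -> K' -> cost K').
Variables (cm ca : counts).
Hypothesis mulP : forall a b x y, L a x -> L b y ->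
  run (mul x y) (L' (a && b)) (mulc (a && b) cm).
Hypothesis addP : forall a b x y, L' a x -> L' b y ->
  run (add x y) (L' (a || b)) (mulc (a && b) ca).

Lemma run_cddotM_full n (x y : CD K n) :
  shape L true true x -> shape L true true y ->
  run (cddotM mul add x y) (L' true)
    (addc (mulc (2 ^ n) cm) (mulc (2 ^ n - 1) ca)).
Proof.
elim: n x y => [|n IHn] x y /=.
  move=> Lx Ly; apply: run_eq (mulP Lx Ly) _.
  by apply: counts_eq => /=; lia.
move=> [x1 x2] [y1 y2]; apply: run_eq.
  apply: (run_bind (IHn _ _ x1 y1)) => z1 S1.
  apply: (run_bind (IHn _ _ x2 y2)) => z2 S2.
  exact: addP S1 S2.
rewrite expnS; have := expn_gt0 2 n; move: (2 ^ n) => [] // H _.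
by apply: counts_eq => /=; nia.
Qed.

(** The vanishing real coordinate saves one product and one sum; a vector of
    dimension one is then entirely zero, and so is the dot product. *)
Lemma run_cddotM_im n (x y : CD K n) :
  shape L false true x -> shape L false true y ->
  run (cddotM mul add x y) (L' (0 < n))
    (addc (mulc (2 ^ n - 1) cm) (mulc (2 ^ n - 2) ca)).
Proof.
elim: n x y => [|n IHn] x y /=.
  move=> Lx Ly; apply: run_eq (mulP Lx Ly) _.
  by apply: counts_eq => /=; lia.
move=> [x1 x2] [y1 y2]; rewrite -[X in L' X](orbT (0 < n)); apply: run_eq.
  apply: (run_bind (IHn _ _ x1 y1)) => z1 S1.
  apply: (run_bind (run_cddotM_full x2 y2)) => z2 S2.
  exact: addP S1 S2.
rewrite expnS andbT; case: n {IHn x y x1 x2 y1 y2} => [|n].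
  by apply: counts_eq => /=; lia.
rewrite expnS; have := expn_gt0 2 n; move: (2 ^ n) => [] // H _.
by apply: counts_eq => /=; nia.
Qed.

End Dot.

(** * Elementary operations *)

Section Operations.
Variable R : realFieldType.

Definition live (b : bool) (a : tracked R) : Prop := isSome a = b.

Definition clive (b : bool) (z : ctracked R) : Prop := live b z.1 /\ live b z.2.

Definition plive (b : bool) (z : prepared R) : Prop :=
  clive b z.1 /\ live b z.2.

Lemma run_tmul a b x y : live a x -> live b y ->
  run (tmul x y) (live (a && b)) (mulc (a && b) (Counts 1 0 0)).
Proof. by case: x y => [?|] [?|] <- <-. Qed.

Lemma run_tadd a b x y : live a x -> live b y ->
  run (tadd x y) (live (a || b)) (mulc (a && b) (Counts 0 1 0)).
Proof. by case: x y => [?|] [?|] <- <-. Qed.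

Lemma run_tsub a b x y : live a x -> live b y ->
  run (tsub x y) (live (a || b)) (mulc (a && b) (Counts 0 1 0)).
Proof. by case: x y => [?|] [?|] <- <-. Qed.

Lemma run_ctadd a b x y : clive a x -> clive b y ->
  run (ctadd x y) (clive (a || b)) (mulc (a && b) (Counts 0 2 0)).
Proof.
by case: x y => [[?|] [?|]] [[?|] [?|]] [] /= <- // _ [] /= <- // _.
Qed.

Lemma run_ctsub a b x y : clive a x -> clive b y ->
  run (ctsub x y) (clive (a || b)) (mulc (a && b) (Counts 0 2 0)).
Proof.
by case: x y => [[?|] [?|]] [[?|] [?|]] [] /= <- // _ [] /= <- // _.
Qed.

Lemma run_cthalf b x : clive b x ->
  run (cthalf x) (clive b) (mulc b (Counts 0 0 2)).
Proof. by case: x => [[?|] [?|]] [] /= <- // _. Qed.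

Lemma run_ctprep b x : clive b x ->
  run (ctprep x) (plive b) (mulc b (Counts 0 1 0)).
Proof. by case: x => [[?|] [?|]] [] /= <- // _. Qed.

Lemma run_ctmul a b x y : plive a x -> plive b y ->
  run (ctmul x y) (clive (a && b)) (mulc (a && b) (Counts 3 3 0)).
Proof.
by case: x y => [[[?|] [?|]] [?|]] [[[?|] [?|]] [?|]] [[/= <- //= _] _]
  [[/= <- //= _] _].
Qed.

(** A live factor does not affect the status of a product; this is what makes
    scaling a vector an instance of [run_cdmapM]. *)
Lemma run_tscale a : live true a -> forall b x, live b x ->
  run (tmul a x) (live b) (mulc b (Counts 1 0 0)).
Proof. by move=> La b x Lx; exact: (run_tmul La Lx). Qed.

Lemma run_ctscale a : plive true a -> forall b x, plive b x ->
  run (ctmul a x) (clive b) (mulc b (Counts 3 3 0)).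
Proof. by move=> La b x Lx; exact: (run_ctmul La Lx). Qed.

Lemma clive_iota b x : clive b x -> clive b (ctiota x).
Proof. by case: x => [[?|] [?|]] [] /= <- // _. Qed.

Lemma clive_fst b x : clive b x -> live b x.1. Proof. by case. Qed.

Lemma clive_snd b x : clive b x -> live b x.2. Proof. by case. Qed.

Lemma clive_zero : clive false (ctzero R).
Proof. by []. Qed.

Lemma shape_Some n (x : CD R n) : shape live true true (cdmap Some x).
Proof. by elim: n x => //= n IHn x. Qed.

(** * The complex nodes *)

(** The work of one node of index m+1 outside its two recursive calls, forming
    their inputs included.  The factor [1 < m] marks what is charged only if the
    calls return live values: per live coordinate, 8 additions form the inputs
    and 8 more combine the results, together with 4 halvings. *)
Definition node_cost m : counts :=
  let H1 := 2 ^ m - 1 in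
  Counts (18 * H1) ((30 + 16 * (1 < m)) * H1) (4 * (1 < m) * H1).

Fixpoint call_cost n : counts :=
  if n is m.+1 then addc (node_cost m) (addc (call_cost m) (call_cost m))
  else Counts 0 0 0.

(** Imaginary inputs are reproduced by the recursive inputs u +- iota s, so the
    pattern of inputs is an invariant of the recursion.  The cost of the pending
    computations [mX] and [mY] enters only when 1 < n, because a call that is
    known to return zero does not evaluate them. *)
Lemma run_qlCM n (mX mY : cost (CD (ctracked R) n)) cX cY :
  run mX (shape clive false true) cX -> run mY (shape clive false true) cY ->
  run (qlCM mX mY) (shape clive false (1 < n))
    (addc (mulc (1 < n) (addc cX cY)) (call_cost n)).
Proof.
elim: n mX mY cX cY => [|m IHm] mX mY cX cY RX RY; first by [].
have [m0|m_gt0] := posnP m.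
  subst m; apply: run_eq (run_ret _) _; first exact: shape_const.
  exact: counts_eq.
cbn [qlCM]; rewrite -[m == 0]negbK -lt0n m_gt0; cbn [negb].
apply: run_eq.
  apply: (run_bind RX) => X [Xu Xs].
  apply: (run_bind RY) => Y [Yu Ys] /=.
  have g := shape_Re Xs; have d := shape_Re Ys.
  have s := shape_setRe clive_zero Xs.
  have t := shape_setRe clive_zero Ys.
  have js := shape_map clive_iota s.
  have jt := shape_map clive_iota t.
  apply: (run_bind (IHm _ _ _ _ (run_cdmap2M run_ctadd Xu js)
    (run_cdmap2M run_ctadd Yu jt))) => Zp SZp.
  apply: (run_bind (IHm _ _ _ _ (run_cdmap2M run_ctsub Xu js)
    (run_cdmap2M run_ctsub Yu jt))) => Zm SZm.
  apply: (run_bind (run_ctprep g)) => g' {}g.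
  apply: (run_bind (run_ctprep d)) => d' {}d.
  apply: (run_bind (run_cdmapM run_ctprep Xu)) => u' u.
  apply: (run_bind (run_cdmapM run_ctprep Yu)) => v' v.
  apply: (run_bind (run_cdmapM run_ctprep s)) => s' {}s.
  apply: (run_bind (run_cdmapM run_ctprep t)) => t' {}t.
  apply: (run_bind (run_cddotM_im run_ctmul run_ctadd s v)) => sv Lsv.
  apply: (run_bind (run_cddotM_im run_ctmul run_ctadd t u)) => tu Ltu.
  apply: (run_bind (run_ctsub Lsv Ltu)) => l Ll.
  apply: (run_bind (run_cdmap2M run_ctadd SZp SZm)) => ZS SZS.
  apply: (run_bind (run_cdmapM run_cthalf SZS)) => ZS2 SZS2.
  apply: (run_bind (run_cdmapM (run_ctscale g) t)) => gt Sgt.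
  apply: (run_bind (run_cdmapM (run_ctscale d) s)) => ds Sds.
  apply: (run_bind (run_cdmap2M run_ctadd SZS2 Sgt)) => F1 SF1.
  apply: (run_bind (run_cdmap2M run_ctsub SF1 Sds)) => F SF.
  apply: (run_bind (run_cdmapM (run_ctscale d) u)) => du Sdu.
  apply: (run_bind (run_cdmapM (run_ctscale g) v)) => gv Sgv.
  apply: (run_bind (run_cdmap2M run_ctsub SZp SZm)) => ZD SZD.
  apply: (run_bind (run_cdmapM run_cthalf SZD)) => ZD2 SZD2.
  have Sl := shape_setRe Ll (shape_const m clive_zero).
  apply: (run_bind (run_cdmap2M run_ctadd Sl Sdu)) => G1 SG1.
  apply: (run_bind (run_cdmap2M run_ctsub SG1 Sgv)) => G2 SG2.
  have SjZD := shape_map clive_iota SZD2.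
  apply: (run_bind (run_cdmap2M run_ctadd SG2 SjZD)) => G SG.
  apply: (@run_ret _ (F, G) (shape clive false (1 < m.+1) (n := m.+1))).
  by split; [apply: (shape_eq SF)
            |apply: (shape_eq SG)]; rewrite ?ltnS ?m_gt0 ?orbT.
rewrite m_gt0 ltnS m_gt0 /nlive /= /node_cost.
(* Only for 1 < m are the recursive values live. *)
have [->|m_gt1] : m = 1 \/ (1 < m) by lia.
  by apply: counts_eq => /=; lia.
have : 2 <= 2 ^ m by rewrite -{1}(expn1 2) leq_exp2l.
rewrite m_gt1; move: (2 ^ m) => [|[|H]] // _.
by apply: counts_eq => /=; lia.
Qed.

(** * The real levels *)

(** The inputs of the complex call are assembled from real vectors for
    free, so the node of R_{m+1} adds real operations only.  As before, adding
    the values of that call is charged only when 1 < m. *)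
Definition real_node_cost m : counts :=
  let H := 2 ^ m in
  addc (Counts (6 * (H - 1)) (2 * (H - 2) + 1 + 2 * (1 + (1 < m)) * (H - 1)) 0)
       (call_cost m).

Lemma run_qlRM m (X Y : CD (tracked R) m.+1) : 0 < m ->
  shape live false true X -> shape live false true Y ->
  run (qlRM X Y) (shape live false true) (real_node_cost m).
Proof.
move=> m_gt0 [Xu Xs] [Yu Ys].
cbn [qlRM]; rewrite -[m == 0]negbK -lt0n m_gt0; cbn [negb].
have live_zero : live false None by [].
apply: run_eq.
  have g := shape_Re Xs; have d := shape_Re Ys.
  have s := shape_setRe live_zero Xs.
  have t := shape_setRe live_zero Ys.
  have pairP b x y : live b x -> live b y -> clive b (x, y) by [].
  have us := shape_map2 pairP Xu s.
  have vt := shape_map2 pairP Yu t.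
  apply: (run_bind (run_qlCM (run_ret us) (run_ret vt))) => Z SZ.
  have ReZ := shape_map clive_fst SZ.
  have ImZ := shape_map clive_snd SZ.
  apply: (run_bind (run_cddotM_im run_tmul run_tadd s Yu)) => sv Lsv.
  apply: (run_bind (run_cddotM_im run_tmul run_tadd t Xu)) => tu Ltu.
  apply: (run_bind (run_tsub Lsv Ltu)) => l Ll.
  apply: (run_bind (run_cdmapM (run_tscale g) t)) => gt Sgt.
  apply: (run_bind (run_cdmapM (run_tscale d) s)) => ds Sds.
  apply: (run_bind (run_cdmap2M run_tadd ReZ Sgt)) => F1 SF1.
  apply: (run_bind (run_cdmap2M run_tsub SF1 Sds)) => F SF.
  apply: (run_bind (run_cdmapM (run_tscale d) Xu)) => du Sdu.
  apply: (run_bind (run_cdmapM (run_tscale g) Yu)) => gv Sgv.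
  have Sl := shape_setRe Ll (shape_const m live_zero).
  apply: (run_bind (run_cdmap2M run_tadd Sl Sdu)) => G1 SG1.
  apply: (run_bind (run_cdmap2M run_tsub SG1 Sgv)) => G2 SG2.
  apply: (run_bind (run_cdmap2M run_tsub SG2 ImZ)) => G SG.
  apply: (@run_ret _ (F, G) (shape live false true (n := m.+1))).
  by split; [apply: (shape_eq SF)
            |apply: (shape_eq SG)]; rewrite ?m_gt0 ?orbT.
rewrite /real_node_cost m_gt0 /nlive /=.
have : 2 <= 2 ^ m by rewrite -{1}(expn1 2) leq_exp2l.
move: (2 ^ m) => [|[|H]] // _.
by case: (1 < m); apply: counts_eq => /=; lia.
Qed.

(** On top of R_{m+1}: one product of real parts, a dot product and two scalings
    over N - 1 coordinates, N - 2 sums in the dot product, one subtraction, and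
    two vector sums charged on N - 1 coordinates, since the scalar term meets
    only known zeros. *)
Lemma run_qlMM m (x y : CD (tracked R) m.+1) : 0 < m ->
  shape live true true x -> shape live true true y ->
  run (qlMM x y) (shape live true true)
    (addc (real_node_cost m)
       (let N := 2 ^ m.+1 in Counts (3 * N - 2) (3 * N - 3) 0)).
Proof.
move=> m_gt0 Sx Sy.
have live_zero : live false None by [].
cbn [qlMM]; apply: run_eq.
  have a := shape_Re Sx; have b := shape_Re Sy.
  have X := shape_setRe live_zero Sx.
  have Y := shape_setRe live_zero Sy.
  apply: (run_bind (run_qlRM m_gt0 X Y)) => Z SZ.
  apply: (run_bind (run_tmul a b)) => ab Lab.
  apply: (run_bind (run_cddotM_im run_tmul run_tadd X Y)) => XY LXY.
  apply: (run_bind (run_tsub Lab LXY)) => sc Lsc.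
  apply: (run_bind (run_cdmapM (run_tscale a) Y)) => aY SaY.
  apply: (run_bind (run_cdmapM (run_tscale b) X)) => bX SbX.
  have Ssc := shape_setRe Lsc (shape_const m.+1 live_zero).
  apply: (run_bind (run_cdmap2M run_tadd Ssc SaY)) => W1 SW1.
  apply: (run_bind (run_cdmap2M run_tadd SW1 SbX)) => W2 SW2.
  have SW := run_cdmap2M run_tadd SW2 SZ; exact: SW.
rewrite /nlive.
have : 2 <= 2 ^ m.+1 by rewrite -{1}(expn1 2) leq_exp2l.
move: (2 ^ m.+1) => [|[|H]] // _.
by apply: counts_eq => /=; lia.
Qed.

Lemma cost_ql_run m (x y : CD R m.+1) : 0 < m ->
  (ql_run x y).2 =
  addc (real_node_cost m)
    (let N := 2 ^ m.+1 in Counts (3 * N - 2) (3 * N - 3) 0).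
Proof.
by move=> m_gt0; apply: proj2 (run_qlMM m_gt0 (shape_Some x) (shape_Some y)).
Qed.

End Operations.

(** * Solving the recurrence *)

(** The recurrence c(k+1) = 2 c(k) + a (2^k - 1) has the solutions
    (a / 2) k 2^k + b 2^k + a, with a = 18, 46, 4 for the three counts and b
    fixed by c(2).  The negative terms b 2^k are moved to the left, as natural
    subtraction would truncate. *)
Lemma call_cost_closed n : 1 < n ->
  let c := call_cost n in let N := 2 ^ n in
  [/\ nmul c + 18 * N = 9 * (n * N) + 18,
      nadd c + 50 * N = 23 * (n * N) + 46
    & nscale c + 5 * N = 2 * (n * N) + 4].
Proof.
case: n => [|[|n]] // _; elim: n => [|n [M A S]]; first by [].
have -> : call_cost n.+3 =
  addc (node_cost n.+2) (addc (call_cost n.+2) (call_cost n.+2)) by [].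
move: (call_cost n.+2) M A S => [cM cA cS].
rewrite /node_cost (expnS 2 n.+2) /=; have := expn_gt0 2 n.+2.
by move: (2 ^ n.+2) => [] // H _ M A S; split; nia.
Qed.

Local Open Scope ring_scope.

Theorem proposition4p4 (R : realType) :
  (forall (n : nat) (x y : CD R n), (3 <= n)%N ->
     let N : rat := (2 ^ n)%N%:R in
     [/\ (M_QL x y)%:R = (9 * n%:R - 15) * N / 2 + 10,
         (A_QL x y)%:R = (23 * n%:R - 61) * N / 2 + 36,
         (S_QL x y)%:R = (2 * n%:R - 7) * N / 2 + 4
       & (T_QL x y)%:R = (34 * n%:R - 83) * N / 2 + 50])
  /\ (forall x y : CD R 1, (M_QL x y, A_QL x y, S_QL x y) = (4, 2, 0)%N)
  /\ (forall x y : CD R 2, (M_QL x y, A_QL x y, S_QL x y) = (16, 12, 0)%N).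
Proof.
split; last first.
  split=> x y; first by [].
  by rewrite /M_QL /A_QL /S_QL cost_ql_run.
move=> [|m] // x y m_gt1; rewrite ltnS in m_gt1.
have [M A S] := call_cost_closed m_gt1.
have H_ge2 : (2 <= 2 ^ m)%N by rewrite -{1}(expn1 2) leq_exp2l // ltnW.
have ME : (2 * M_QL x y + 15 * 2 ^ m.+1 = 9 * (m.+1 * 2 ^ m.+1) + 20)%N.
  by rewrite /M_QL cost_ql_run 1?ltnW //= expnS; nia.
have AE : (2 * A_QL x y + 61 * 2 ^ m.+1 = 23 * (m.+1 * 2 ^ m.+1) + 72)%N.
  by rewrite /A_QL cost_ql_run 1?ltnW //= m_gt1 expnS; nia.
have SE : (2 * S_QL x y + 7 * 2 ^ m.+1 = 2 * (m.+1 * 2 ^ m.+1) + 8)%N.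
  by rewrite /S_QL cost_ql_run 1?ltnW //= expnS; nia.
move=> N; rewrite /T_QL !natrD.
have {}ME := congr1 (fun k => k%:R : rat) ME.
have {}AE := congr1 (fun k => k%:R : rat) AE.
have {}SE := congr1 (fun k => k%:R : rat) SE.
rewrite !(natrD, natrM) -/N in ME AE SE.
by split; lra.
Qed.
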